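(* For each integer $n\ge2$, $${}_{n-1}F_{n-2}\left(\begin{array}{c}-\frac1n;\ \frac1n,\dots,\frac{n-2}n\\ \frac1{n-1},\dots,\frac{n-2}{n-1}\end{array}\mid-\,\frac{n^n}{(n-1)^{n-1}}\,\frac{s}{(1-s)^n}\right)=\frac{(n-1)+s}{(n-1)(1-s)}$$ in a neighborhood of $s=0$.
   Context: ${}_{m}F_{m-1}(a_1,\dots,a_m;b_1,\dots,b_{m-1};\zeta)=\sum_{k\ge0}\frac{(a_1)_k\cdots(a_m)_k}{(b_1)_k\cdots(b_{m-1})_k(1)_k}\zeta^k$ with $(c)_k=c(c+1)\cdots(c+k-1)$. For $n=2$ the lists $\frac1n,\dots,\frac{n-2}n$ and $\frac1{n-1},\dots,\frac{n-2}{n-1}$ are empty. *)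

(* Defs.v *)
From mathcomp Require Import all_boot all_order all_algebra.
From mathcomp Require Import all_classical all_reals all_analysis.
From mathcomp Require Export complex.

Set Implicit Arguments.
Unset Strict Implicit.
Unset Printing Implicit Defensive.

Import Order.TTheory GRing.Theory Num.Theory.
Import numFieldNormedType.Exports.

Local Open Scope classical_set_scope.
Local Open Scope ring_scope.

Definition pochhammer (K : numFieldType) (c : K) (k : nat) : K :=
  \prod_(i < k) (c + i%:R).

Definition hypergeom_term (K : numFieldType) (a b : seq K) (z : K) (k : nat)
  : K :=
  (\prod_(c <- a) pochhammer c k)
    / ((\prod_(c <- b) pochhammer c k) * pochhammer 1 k) * z ^+ k.

(* The series defining pFq(a; b; z) with p = size a and q = size b. *)
Definition hypergeom_series (K : numFieldType) (a b : seq K) (z : K)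
  : nat -> K :=
  series (hypergeom_term a b z).

(* Total function: it is the sum of the series only when that series
   converges, so convergence has to be asserted separately. *)
Definition hypergeom (K : numFieldType) (a b : seq K) (z : K) : K :=
  limn (hypergeom_series a b z).

(* 1/d, 2/d, ..., m/d *)
Definition fractions (K : numFieldType) (m d : nat) : seq K :=
  [seq j%:R / d%:R | j <- iota 1 m].

(* R[i] bundled as a numFieldType, through which it receives the topology
   induced by the modulus. *)
Definition Cplx (R : realType) : numFieldType := R[i].

(* Main.v *)
(* With w = s/(1-s)^n, Gauss's multiplication formula turns the k-th term of the
   series into c_k (-w)^k, where c_k = -C(nk,k)/(nk-1).  Multiplying the
   difference of the L-th partial sum and the right-hand side by (1-s)^(nL+1)
   gives a polynomial in s.  Its first L coefficients vanish: modulo s^L one may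
   divide back by (1-s)^(nL+1), and for i > 0 the i-th coefficient of the partial
   sum is then -1/i! times sum_k (-1)^k C(i,k) P(k)/(k-1/n) for a polynomial P of
   degree i; since deg P <= i, this sum is P(1/n) i!/prod_(j <= i) (j-1/n).
   Bounding the coefficients by a majorant and using divisibility by s^L, the
   polynomial is O((2^(n+1) |s|)^L), so the partial sums converge geometrically
   for small s. *)
Require Import Defs.
From mathcomp Require Import all_boot all_order all_algebra.
From mathcomp Require Import all_classical all_reals all_analysis.
From mathcomp Require Import ring zify.
Import Order.TTheory GRing.Theory Num.Theory.
Import numFieldNormedType.Exports.

Set Implicit Arguments.
Unset Strict Implicit.
Unset Printing Implicit Defensive.

Local Open Scope classical_set_scope.
Local Open Scope ring_scope.

(** * Alternating binomial sums *)

(** Absorption [(N+1-k) C(N+1,k) = (N+1) C(N,k)]; the factor [N+1-k] kills the extra last term. *)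
Lemma sum_sign_bin_absorb {K : numFieldType} (N : nat) (g : nat -> K) :
  \sum_(k < N.+2) (-1) ^+ k * 'C(N.+1, k)%:R * ((N.+1%:R - k%:R) * g k) =
  N.+1%:R * \sum_(k < N.+1) (-1) ^+ k * 'C(N, k)%:R * g k.
Proof.
rewrite big_ord_recr /= subrr mul0r mulr0 addr0 big_distrr /=.
apply: eq_bigr => k _.
have /(congr1 (fun m => m%:R : K)) := mul_bin_down N.+1 k.
rewrite /= !natrM natrB; last by rewrite ltnW.
move=> E; rewrite [RHS]mulrA [X in _ = X * _]mulrCA E; ring.
Qed.

Lemma sum_sign_bin0 (K : numFieldType) (N : nat) :
  \sum_(k < N.+2) (-1) ^+ k * 'C(N.+1, k)%:R = 0 :> K.
Proof.
have := exprDn (1 : K) (-1) N.+1.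
rewrite subrr expr0n /= => E; rewrite [RHS]E.
by apply: eq_bigr => i _; rewrite expr1n mul1r mulr_natr.
Qed.

(** Partial fraction decomposition in [a] of the right-hand side, which is proper because
    [deg P <= N]. The induction divides [P] by [X - (N+1)]: absorption treats the quotient, and only
    the constant remainder is left. *)
Lemma sum_sign_bin_poly_div {K : numFieldType} (N : nat) (P : {poly K}) (a : K) :
    (size P <= N.+1)%N -> (forall i, (i <= N)%N -> i%:R - a != 0) ->
  \sum_(k < N.+1) (-1) ^+ k * 'C(N, k)%:R * (P.[k%:R] / (k%:R - a)) =
  P.[a] * N`!%:R / \prod_(i < N.+1) (i%:R - a).
Proof.
elim: N P => [|N IHN] P szP ha.
  rewrite (size1_polyC szP) !big_ord_recl !big_ord0 !hornerC.
  by rewrite bin0 fact0 !mulr1 mul1r addr0.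
have ha' i : (i <= N)%N -> i%:R - a != 0 by move=> iN; apply: ha; exact: leqW.
have haN : N.+1%:R - a != 0 by apply: ha.
have prod0 : \prod_(i < N.+1) (i%:R - a) != 0.
  by apply/prodf_neq0 => i _; apply: ha'; rewrite -ltnS.
have prodE : \prod_(i < N.+2) (i%:R - a) =
    \prod_(i < N.+1) (i%:R - a) * (N.+1%:R - a) by rewrite big_ord_recr.
(* Constant case, from [(N+1-k)/(k-a) = (N+1-a)/(k-a) - 1]; the [-1] contributes an alternating sum
   of binomials, which is zero. *)
have inv_sum : \sum_(k < N.+2) (-1) ^+ k * 'C(N.+1, k)%:R * (k%:R - a)^-1 =
    N.+1`!%:R / \prod_(i < N.+2) (i%:R - a).
  have := sum_sign_bin_absorb N (fun k => (k%:R - a)^-1).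
  have -> : \sum_(k < N.+2) (-1) ^+ k * 'C(N.+1, k)%:R *
      ((N.+1%:R - k%:R) * (k%:R - a)^-1) =
    (N.+1%:R - a) * \sum_(k < N.+2) (-1) ^+ k * 'C(N.+1, k)%:R * (k%:R - a)^-1 -
    \sum_(k < N.+2) (-1) ^+ k * 'C(N.+1, k)%:R.
    rewrite big_distrr -sumrB /=; apply: eq_bigr => k _.
    have : k%:R - a != 0 by apply: ha; rewrite -ltnS.
    by move=> ?; field.
  rewrite sum_sign_bin0 subr0.
  have := IHN 1; rewrite size_poly1 => /(_ isT ha').
  under eq_bigr => k _ do rewrite hornerC div1r.
  move=> ->; rewrite hornerC mul1r => E.
  apply: (mulfI haN); rewrite E prodE factS natrM.
  move: prod0 haN; move: (\prod_(i < N.+1) _) (N.+1%:R : K) => p x p0 x0.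
  by field; rewrite p0 x0.
have /factor_theorem[Q PQ] : root (P - (P.[N.+1%:R])%:P) N.+1%:R.
  by rewrite /root !hornerE subrr.
have {PQ} PE : P = Q * ('X - (N.+1%:R)%:P) + (P.[N.+1%:R])%:P.
  by rewrite -PQ subrK.
set c := P.[N.+1%:R] in PE.
have szQ : (size Q <= N.+1)%N.
  have [->|Q0] := eqVneq Q 0; first by rewrite size_poly0.
  have : (size (Q * ('X - (N.+1%:R)%:P))%R <= N.+2)%N.
    have -> : Q * ('X - (N.+1%:R)%:P) = P - c%:P by rewrite PE addrK.
    apply: leq_trans (size_polyD _ _) _; rewrite geq_max szP size_polyN.
    by apply: leq_trans (size_polyC_leq1 _) _.
  by rewrite size_Mmonic ?monicXsubC // size_XsubC addn2.
have -> : \sum_(k < N.+2) (-1) ^+ k * 'C(N.+1, k)%:R * (P.[k%:R] / (k%:R - a)) =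
   - \sum_(k < N.+2) (-1) ^+ k * 'C(N.+1, k)%:R *
      ((N.+1%:R - k%:R) * (Q.[k%:R] / (k%:R - a))) +
   c * \sum_(k < N.+2) (-1) ^+ k * 'C(N.+1, k)%:R * (k%:R - a)^-1.
  rewrite -sumrN big_distrr -big_split /=; apply: eq_bigr => k _.
  have ka : k%:R - a != 0 by apply: ha; rewrite -ltnS.
  by rewrite {1}PE hornerD hornerM hornerXsubC hornerC; field.
rewrite (sum_sign_bin_absorb N (fun k => Q.[k%:R] / (k%:R - a))) (IHN _ szQ ha').
rewrite inv_sum {1}PE hornerD hornerM hornerXsubC hornerC.
rewrite prodE factS natrM.
move: prod0 haN; clearbody c; clear.
move: (\prod_(i < N.+1) _) (N.+1%:R : K) => p x p0 x0.
by field; rewrite p0 x0.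
Qed.

(** * Coefficients of the series and their binomial convolution *)

(* Up to the factor n/(n - 1), [hcoef K n k] is for k > 0 the coefficient of z^k
   in B(z)^-1, where B = 1 + z B^n. *)
Definition hcoef (K : numFieldType) (n k : nat) : K :=
  - ('C(n * k, k)%:R / ((n * k)%:R - 1)).

Lemma fact_addE (m N : nat) : ((m + N)`! = m`! * \prod_(i < N) (m + i.+1))%N.
Proof.
elim: N => [|N IHN]; first by rewrite big_ord0 addn0 muln1.
by rewrite addnS factS IHN big_ord_recr /= addnS; ring.
Qed.

(** In factorials, [(nk)!/(nk-1)! = nk] and [((n-1)k+N)!/((n-1)k)!] is the product on the right.
    Thus, apart from [C(N+1,k)], the dependence on [k] is polynomial of degree at most [N+1]. At
    [k = 0] both sides vanish. *)
Lemma bin_mul_bin (n N k : nat) : (0 < n)%N -> (k <= N.+1)%N ->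
  ('C(n * k, k) * 'C((n * k + (N.+1 - k)).-1, N.+1 - k) * N.+1`! =
   'C(N.+1, k) * (n * k * \prod_(i < N) ((n - 1) * k + i.+1)))%N.
Proof.
case: n => // n _; rewrite subn1 /=.
case: k => [_|k kN].
  by rewrite !(muln0, mul0n) subn0 add0n /= (bin_small (ltnSn N)) !(muln0, mul0n).
have E1 : ('C(n.+1 * k.+1, k.+1) * (k.+1`! * (n * k.+1)`!) = (n.+1 * k.+1)`!)%N.
  have -> : (n * k.+1 = n.+1 * k.+1 - k.+1)%N by rewrite mulSn addKn.
  by apply: bin_fact; rewrite mulSn leq_addr.
have E2 : ('C((n.+1 * k.+1 + (N.+1 - k.+1)).-1, N.+1 - k.+1) *
   ((N.+1 - k.+1)`! * ((n.+1 * k.+1).-1)`!) = (n * k.+1 + N)`!)%N.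
  have -> : (n * k.+1 + N = (n.+1 * k.+1 + (N.+1 - k.+1)).-1)%N by lia.
  have -> : ((n.+1 * k.+1).-1 =
      (n.+1 * k.+1 + (N.+1 - k.+1)).-1 - (N.+1 - k.+1))%N.
    by lia.
  by apply: bin_fact; lia.
have E3 := bin_fact kN.
have E4 : ((n.+1 * k.+1)`! = n.+1 * k.+1 * ((n.+1 * k.+1).-1)`!)%N.
  by rewrite mulSn addSn factS.
have E5 := fact_addE (n * k.+1) N.
have p1 := fact_gt0 k.+1; have p2 := fact_gt0 (N.+1 - k.+1).
have p3 := fact_gt0 (n * k.+1); have p4 := fact_gt0 (n.+1 * k.+1).-1.
move: E1 E2 E3 E4 E5 p1 p2 p3 p4.
set a := (n.+1 * k.+1)`!; set b := ((n.+1 * k.+1).-1)`!; set d := N.+1`!.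
set e := k.+1`!; set f := (n * k.+1)`!; set g := (N.+1 - k.+1)`!.
set h := (n * k.+1 + N)`!; set A := 'C(n.+1 * k.+1, k.+1).
set B := 'C(_, N.+1 - k.+1); set C := 'C(N.+1, k.+1); set Pr := (\prod_(i < N) _)%N.
set nk := (n.+1 * k.+1)%N.
move: a b d e f g h A B C Pr nk => a b d e f g h A B C Pr nk.
move=> E1 E2 E3 E4 E5 e0 g0 f0 b0.
apply/eqP; rewrite -(@eqn_pmul2r (e * f * (g * b))) ?muln_gt0 ?e0 ?f0 ?g0 ?b0 //.
have -> : (A * B * d * (e * f * (g * b)) = A * (e * f) * (B * (g * b)) * d)%N by ring.
rewrite E1 E2 E4 E5 -E3; apply/eqP; ring.
Qed.

Lemma natr_mul_neq1 {K : numFieldType} (n i : nat) : (1 < n)%N ->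
  n%:R * i%:R != 1 :> K.
Proof.
move=> n1; rewrite -natrM pnatr_eq1.
by case: i => [|i]; [rewrite muln0 | rewrite mulnS; case: n n1 => [|[]]].
Qed.

Lemma natr_sub_inv_neq0 {K : numFieldType} (n i : nat) : (1 < n)%N ->
  i%:R - n%:R^-1 != 0 :> K.
Proof.
move=> n1; have n0 : n%:R != 0 :> K by rewrite pnatr_eq0; case: n n1.
rewrite subr_eq0; apply/eqP => iE; have := @natr_mul_neq1 K n i n1.
by rewrite iE divff // eqxx.
Qed.

(** The left-hand side is the coefficient of [X^N] in the sum over [k] of [hcoef K n k] times
    [(-X)^k (1-X)^(-nk)], the right-hand side that in [1 + n/(n-1) X/(1-X)]. *)
Lemma sum_hcoef_bin {K : numFieldType} (n N : nat) : (2 <= n)%N ->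
  \sum_(k < N.+1) (-1) ^+ k * hcoef K n k * 'C((n * k + (N - k)).-1, N - k)%:R =
  if N is 0%N then 1 else n%:R / (n - 1)%:R.
Proof.
move=> n2; case: N => [|N].
  by rewrite big_ord_recl big_ord0 /hcoef muln0 !bin0 expr0 sub0r invrN1
    mulrN1 opprK !mulr1 addr0.
have n0 : n%:R != 0 :> K by rewrite pnatr_eq0; case: n n2.
have n10 : (n - 1)%:R != 0 :> K by rewrite pnatr_eq0 subn_eq0 -ltnNge.
have f0 : N.+1`!%:R != 0 :> K by rewrite pnatr_eq0 -lt0n fact_gt0.
(* Since [nk/(nk-1) = k/(k-1/n)], the factor [nk] from [bin_mul_bin] gives the ['X] in [P], and the
   denominator of [hcoef] gives the pole [a = 1/n]. *)
pose L i : {poly K} := (n - 1)%:R *: 'X + i.+1%:R%:P.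
pose P := 'X * \prod_(i < N) L i.
have PE x : P.[x] = x * \prod_(i < N) ((n - 1)%:R * x + i.+1%:R).
  rewrite hornerM hornerX horner_prod; congr (_ * _); apply: eq_bigr => i _.
  by rewrite hornerD hornerZ hornerX hornerC.
have szP : (size P <= N.+2)%N.
  rewrite /P mulrC size_mulX; last first.
    apply/prodf_neq0 => i _; apply/eqP => /(congr1 (fun p => p.[0])) /eqP.
    by rewrite hornerD hornerZ hornerX hornerC horner0 mulr0 add0r pnatr_eq0.
  rewrite ltnS; elim: N {PE f0 P} => [|N IHN].
    by rewrite big_ord0 size_poly1.
  rewrite big_ord_recr /=; apply: leq_trans (size_polyMleq _ _) _.
  have : (size (L N) <= 2)%N.
    apply: leq_trans (size_polyD _ _) _; rewrite geq_max.
    rewrite (leq_trans (size_scale_leq _ _)) ?size_polyX //=.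
    by apply: leq_trans (size_polyC_leq1 _) _.
  move=> szL; apply: (@leq_trans (N.+1 + 2).-1); last by rewrite addn2.
  by rewrite -!subn1 leq_sub2r // leq_add.
have := sum_sign_bin_poly_div szP (fun i _ => @natr_sub_inv_neq0 K n i n2).
(* The factors [i - 1/n] with [i >= 2] are those of the product in [P.[1/n]], so they cancel. *)
have -> : \prod_(i < N.+2) (i%:R - n%:R^-1) = - n%:R^-1 *
    ((n - 1)%:R * n%:R^-1 * \prod_(i < N) ((n - 1)%:R * n%:R^-1 + i.+1%:R)) :> K.
  rewrite !big_ord_recl sub0r; congr (_ * (_ * _)).
    by rewrite lift0 natrB ?(ltnW n2) //=; field.
  apply: eq_bigr => i _.
  by rewrite !lift0 natrB ?(ltnW n2) // -[i.+2%:R]natr1; field.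
have q0 : \prod_(i < N) ((n - 1)%:R * n%:R^-1 + i.+1%:R) != 0 :> K.
  apply/prodf_neq0 => i _; apply: lt0r_neq0.
  by rewrite ltr_wpDl ?ltr0n // divr_ge0.
rewrite PE => E.
have -> : \sum_(k < N.+2) (-1) ^+ k * hcoef K n k *
    'C((n * k + (N.+1 - k)).-1, N.+1 - k)%:R =
  - N.+1`!%:R^-1 * \sum_(k < N.+2) (-1) ^+ k * 'C(N.+1, k)%:R *
     (P.[k%:R] / (k%:R - n%:R^-1)).
  rewrite big_distrr /=; apply: eq_bigr => k _.
  have kN : (k <= N.+1)%N by rewrite -ltnS.
  have /(congr1 (fun m => m%:R : K)) := bin_mul_bin (ltnW n2) kN.
  move: f0; move: (N.+1`!)%N => F F0; rewrite !natrM natr_prod PE /hcoef natrM.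
  under eq_bigr => i _ do rewrite natrD natrM.
  have h1 : n%:R * k%:R - 1 != 0 :> K by rewrite subr_eq0 natr_mul_neq1.
  move: (\prod_(i < N) _) => p Ek.
  have h2 := @natr_sub_inv_neq0 K n k n2.
  have {}Ek : 'C(n * k, k)%:R * 'C((n * k + (N.+1 - k)).-1, N.+1 - k)%:R =
      F%:R^-1 * ('C(N.+1, k)%:R * (n%:R * k%:R * p)).
    by rewrite -Ek [RHS]mulrC mulfK.
  rewrite mulrN mulrA mulNr mulrAC -[X in - (X / _)]mulrA Ek.
  by field; rewrite n0 F0 andbT mulrC h1.
rewrite E; move: q0 f0.
move: (\prod_(i < N) _) (N.+1`!) => q F q0 F0.
by field; rewrite F0 q0 n0 n10.
Qed.

(** * Polynomials as power series modulo [X^L] *)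

Definition eq_trunc {K : numFieldType} (L : nat) (p q : {poly K}) : Prop :=
  forall i, (i < L)%N -> p`_i = q`_i.

Lemma eq_truncM {K : numFieldType} L (r p q : {poly K}) :
  eq_trunc L p q -> eq_trunc L (r * p) (r * q).
Proof.
move=> pq i iL; rewrite !coefM; apply: eq_bigr => j _.
by rewrite pq // (leq_ltn_trans (leq_subr _ _) iL).
Qed.

Lemma eq_trunc_trans {K : numFieldType} L (q p r : {poly K}) :
  eq_trunc L p q -> eq_trunc L q r -> eq_trunc L p r.
Proof. by move=> pq qr i iL; rewrite pq // qr. Qed.

(* Truncation of the expansion of [(1 - X)^-m]. *)
Definition negbin (K : numFieldType) (L m : nat) : {poly K} :=
  \poly_(j < L) 'C((m + j).-1, j)%:R.

(** The truncated predecessor gives the right coefficients here: [C(0,0) = 1], and [C(j-1,j) = 0]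
    for [j > 0]. *)
Lemma negbin0 (K : numFieldType) L : eq_trunc L (negbin K L 0) 1.
Proof.
move=> i iL; rewrite coef_poly iL coef1; case: i iL => // i _.
by rewrite bin_small.
Qed.

(** Coefficientwise, this is Pascal's rule. *)
Lemma negbinS (K : numFieldType) L m :
  eq_trunc L ((1 - 'X) * negbin K L m.+1) (negbin K L m).
Proof.
move=> i iL; rewrite mulrBl mul1r coefB coefXM !coef_poly iL.
case: i iL => [_|i iL /=]; first by rewrite subr0 !bin0.
by rewrite (ltnW iL) !addnS /= binS natrD addrK.
Qed.

Lemma negbinD (K : numFieldType) L a b :
  eq_trunc L ((1 - 'X) ^+ a * negbin K L (a + b)) (negbin K L b).
Proof.
elim: a => [|a IHa]; first by rewrite expr0 mul1r.
rewrite exprSr -mulrA; apply: eq_trunc_trans IHa.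
by apply: eq_truncM; exact: negbinS.
Qed.

(** * The error polynomial and its low coefficients *)

(* [(1 - X)^(n L + 1)] times the difference between the [L]-th partial sum,
   seen as a function of [X = s], and the claimed value of the series. *)
Definition error_poly (K : numFieldType) (n L : nat) : {poly K} :=
  (1 - 'X) * (\sum_(k < L)
     hcoef K n k *: ((- 'X) ^+ k * (1 - 'X) ^+ (n * (L - k))))
  - (1 - 'X) ^+ (n * L) * (1 - 'X + (n%:R / (n - 1)%:R) *: 'X).

(** [negbin K L (n * L + 1)] inverts [(1-X)^(nL+1)] modulo [X^L]; after multiplication by it, the
    low coefficients are the sums of [sum_hcoef_bin] minus the coefficients of the claimed value. *)
Lemma error_poly_trunc (K : numFieldType) (n L : nat) : (2 <= n)%N ->
  eq_trunc L (error_poly K n L) 0.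
Proof.
move=> n2; set G := error_poly K n L.
have GW : eq_trunc L (G * negbin K L (n * L + 1)) 0.
  (* Splitting [nL+1 = (n(L-k)+1) + nk] lets [negbinD] reduce the [k]-th summand to
     [X^k (1-X)^(-nk)]; the subtracted part becomes [1 + n/(n-1) X/(1-X)]. *)
  have GE : G * negbin K L (n * L + 1) =
      \sum_(k < L) ((- 1) ^+ k * hcoef K n k) *: ('X^k *
       ((1 - 'X) ^+ (n * (L - k) + 1) * negbin K L (n * (L - k) + 1 + n * k)))
    - ((1 - 'X) ^+ (n * L + 1) * negbin K L (n * L + 1 + 0)
       + (n%:R / (n - 1)%:R) *:
         ('X * ((1 - 'X) ^+ (n * L) * negbin K L (n * L + 1)))).
    rewrite /G /error_poly addn0 big_distrr mulrBl big_distrl /=.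
    congr (_ - _).
      apply: eq_bigr => k _.
      have -> : (n * (L - k) + 1 + n * k = n * L + 1)%N.
        by rewrite addnAC -mulnDr subnK // ltnW.
      rewrite -scaleN1r exprZn !addn1 exprSr -!mul_polyC polyCM.
      by move: ((_ ^+ k)%:P) (hcoef _ _ _)%:P (negbin _ _ _) => u v w; ring.
    by rewrite !addn1 exprSr -!mul_polyC; move: (_%:P) (negbin _ _ _) => u v; ring.
  move=> i iL; rewrite GE coefB coefD coefZ coefXM coef_sum.
  rewrite (negbinD _ _ _ iL) (negbin0 _ iL) coef1.
  have -> : \sum_(k < L) (((- 1) ^+ k * hcoef K n k) *: ('X^k *
       ((1 - 'X) ^+ (n * (L - k) + 1) * negbin K L (n * (L - k) + 1 + n * k))))`_i =
     \sum_(k < i.+1) (-1) ^+ k * hcoef K n k * 'C((n * k + (i - k)).-1, i - k)%:R.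
    rewrite (big_ord_widen L (fun k => (-1) ^+ k * hcoef K n k *
      'C((n * k + (i - k)).-1, i - k)%:R)) // [RHS]big_mkcond /=.
    apply: eq_bigr => k _; rewrite coefZ coefXnM ltnS.
    case: leqP => ki /=; last by rewrite mulr0.
    have ikL : (i - k < L)%N by apply: leq_ltn_trans (leq_subr _ _) iL.
    by rewrite (negbinD _ _ _ ikL) coef_poly ikL.
  rewrite sum_hcoef_bin //; case: i iL {GE} => [_|i iL] /=.
    by rewrite mulr0 addr0 subrr coef0.
  have iL' : (i < L)%N by exact: ltnW.
  by rewrite (negbinD _ _ _ iL') coef_poly iL' add1n binn mulr1 add0r subrr coef0.
(* Multiplying back by [(1-X)^(nL+1)], a unit modulo [X^L], carries the vanishing over to [G]. *)
have -> : G = G * 1 by rewrite mulr1.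
apply: (@eq_trunc_trans _ _
  (G * ((1 - 'X) ^+ (n * L + 1) * negbin K L (n * L + 1 + 0)))).
  by apply: eq_truncM => i iL; rewrite (negbinD _ _ _ iL) (negbin0 _ iL).
rewrite addn0 mulrCA -[X in eq_trunc _ _ X](mulr0 ((1 - 'X) ^+ (n * L + 1))).
exact: eq_truncM.
Qed.

(** * Majorants and the geometric bound *)

(** The coefficients of [P] bound norms, so they are automatically real and nonnegative even though
    [K] is only partially ordered. *)
Definition majorized {K : numFieldType} (p P : {poly K}) : Prop :=
  forall i, `|p`_i| <= P`_i.

Lemma majorizedD {K : numFieldType} (p q P Q : {poly K}) :
  majorized p P -> majorized q Q -> majorized (p + q) (P + Q).
Proof.
by move=> pP qQ i; rewrite !coefD (le_trans (ler_normD _ _)) // lerD.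
Qed.

Lemma majorizedN {K : numFieldType} (p P : {poly K}) :
  majorized p P -> majorized (- p) P.
Proof. by move=> pP i; rewrite coefN normrN. Qed.

Lemma majorizedM {K : numFieldType} (p q P Q : {poly K}) :
  majorized p P -> majorized q Q -> majorized (p * q) (P * Q).
Proof.
move=> pP qQ i; rewrite !coefM (le_trans (ler_norm_sum _ _ _)) //.
by apply: ler_sum => j _; rewrite normrM ler_pM.
Qed.

Lemma majorized_refl {K : numFieldType} (p : {poly K}) :
  (forall i, 0 <= p`_i) -> majorized p p.
Proof. by move=> p0 i; rewrite ger0_norm. Qed.

Lemma majorized1 (K : numFieldType) : majorized (1 : {poly K}) 1.
Proof. by apply: majorized_refl => i; rewrite coef1 ler0n. Qed.

Lemma majorizedX (K : numFieldType) : majorized ('X : {poly K}) 'X.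
Proof. by apply: majorized_refl => i; rewrite coefX ler0n. Qed.

Lemma majorized_exp {K : numFieldType} (p P : {poly K}) m :
  majorized p P -> majorized (p ^+ m) (P ^+ m).
Proof.
move=> pP; elim: m => [|m IHm]; first by rewrite !expr0; exact: majorized1.
by rewrite !exprS; exact: majorizedM.
Qed.

Lemma majorizedZ {K : numFieldType} (a b : K) (p P : {poly K}) :
  `|a| <= b -> majorized p P -> majorized (a *: p) (b *: P).
Proof. by move=> ab pP i; rewrite !coefZ normrM ler_pM. Qed.

Lemma majorized_sum {K : numFieldType} m (p P : 'I_m -> {poly K}) :
  (forall k, majorized (p k) (P k)) ->
  majorized (\sum_(k < m) p k) (\sum_(k < m) P k).
Proof.
move=> pP i; rewrite !coef_sum (le_trans (ler_norm_sum _ _ _)) //.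
by apply: ler_sum => j _; exact: pP.
Qed.

(** Terms of degree below [L] vanish, and [|s|^i <= |s|^L] for [i >= L]; [P.[1]] sums the
    coefficients of the majorant. *)
Lemma majorized_horner {K : numFieldType} (L : nat) (p P : {poly K}) (s : K) :
  majorized p P -> eq_trunc L p 0 -> `|s| <= 1 ->
  `|p.[s]| <= `|s| ^+ L * P.[1].
Proof.
move=> pP p0 s1.
have sz : (size p <= size P)%N.
  apply/leq_sizeP => j Pj; apply/normr0_eq0/le_anti; rewrite normr_ge0 andbT.
  by have := pP j; rewrite (nth_default _ Pj).
rewrite (horner_coef_wide _ sz) horner_coef big_distrr /=.
apply: le_trans (ler_norm_sum _ _ _) _; apply: ler_sum => i _.
rewrite expr1n mulr1 normrM normrX mulrC.
have [iL|Li] := ltnP i L.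
  by rewrite p0 // coef0 normr0 mulr0 mulr_ge0 ?exprn_ge0 // (le_trans _ (pP i)).
by rewrite ler_pM ?exprn_ge0 // ler_wiXn2l.
Qed.

(** [C(nk,k)] is one term of [(1+1)^(nk)], and the denominator has norm at least 1: it is -1 at
    [k = 0] and at least 1 afterwards, as [n >= 2]. *)
Lemma norm_hcoef_le (K : numFieldType) (n k : nat) : (2 <= n)%N ->
  `|hcoef K n k| <= (2 ^ (n * k))%:R.
Proof.
move=> n2; rewrite normrN normrM normfV normr_nat.
have bin_le : ('C(n * k, k) <= 2 ^ (n * k))%N.
  rewrite -[X in (X ^ _)%N]/(1 + 1)%N Pascal.
  have kl : (k < (n * k).+1)%N by rewrite ltnS leq_pmull // ltnW.
  rewrite (bigD1 (Ordinal kl)) //= !exp1n !muln1; exact: leq_addr.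
case: k bin_le => [|k] bin_le.
  by rewrite !muln0 bin0 sub0r normrN normr1 invr1 mulr1.
apply: le_trans (_ : 'C(n * k.+1, k.+1)%:R <= _); last by rewrite ler_nat.
rewrite ler_pdivrMr ?ler_peMr ?ler0n //.
  rewrite ger0_norm; first by rewrite lerBrDr -(natrD _ 1 1) ler_nat; nia.
  by rewrite subr_ge0 ler1n muln_gt0 /= ltnW.
by rewrite normr_gt0 subr_eq0 natrM natr_mul_neq1.
Qed.

Lemma norm_error_poly_le (K : numFieldType) (n L : nat) (s : K) : (2 <= n)%N ->
  `|s| <= 1 ->
  `|(error_poly K n L).[s]| <= 4 * (2 ^+ n.+1 * `|s|) ^+ L.
Proof.
move=> n2 s1.
(* [P] turns every minus sign of [error_poly] into a plus and bounds [hcoef K n k] by [2^(nk)] and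
   [n/(n-1)] by 2. *)
pose P : {poly K} :=
  (1 + 'X) * (\sum_(k < L)
     (2 ^ (n * k))%:R *: ('X ^+ k * (1 + 'X) ^+ (n * (L - k))))
  + (1 + 'X) ^+ (n * L) * (1 + 'X + 2 *: 'X).
have maj1 : majorized (1 - 'X) (1 + 'X : {poly K}).
  by apply: majorizedD (majorized1 K) _; exact/majorizedN/majorizedX.
have maj : majorized (error_poly K n L) P.
  apply: majorizedD; last apply/majorizedN; apply: majorizedM => //.
  - apply: majorized_sum => k; apply: majorizedZ; first exact: norm_hcoef_le.
    apply: majorizedM; apply: majorized_exp => //.
    exact/majorizedN/majorizedX.
  - exact: majorized_exp.
  - apply: majorizedD => //; apply: majorizedZ; last exact: majorizedX.
    rewrite ger0_norm ?divr_ge0 // ler_pdivrMr ?ltr0n ?subn_gt0 //.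
    by rewrite -natrM ler_nat; lia.
apply: le_trans (majorized_horner maj (@error_poly_trunc K n L n2) s1) _.
(* At 1 each summand is [2^(nk) 2^(n(L-k)) = 2^(nL)], so the first part gives [2L] such powers and
   the second gives 4. Then [2L + 4 <= 4 2^L] raises the exponent from [n] to [n+1]. *)
have -> : P.[1] = (2 * L + 4)%:R * 2 ^+ (n * L).
  rewrite /P hornerD !hornerM horner_sum.
  rewrite !(hornerD, hornerZ, hornerX, hornerC, horner_exp).
  rewrite (eq_bigr (fun _ => 2 ^+ (n * L))); last first.
    move=> k _; rewrite !(hornerD, hornerZ, hornerX, hornerC, horner_exp, hornerM).
    rewrite expr1n mul1r natrX -exprD -mulnDr subnKC //; exact: ltnW.
  rewrite sumr_const card_ord -[_ *+ L]mulr_natr natrD natrM.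
  have -> : 1 + 1 = 2 :> K by [].
  by move: (2 ^+ (n * L)) => t; ring.
have L2 : (2 * L + 4 <= 4 * 2 ^ L)%N.
  by elim: L {maj P} => // L IHL; rewrite expnS; lia.
rewrite exprMn -exprM mulSn exprD.
move: (2 ^+ (n * L)) (exprn_ge0 (n * L) (ler0n K 2)) => t t0.
have -> : 4 * (2 ^+ L * t * `|s| ^+ L) = `|s| ^+ L * ((4 * 2 ^ L)%:R * t).
  by rewrite natrM natrX; ring.
by rewrite ler_wpM2l ?exprn_ge0 // ler_wpM2r // ler_nat.
Qed.

(** * Pochhammer products and Gauss's multiplication formula *)

Lemma pochhammerS {K : numFieldType} (c : K) k :
  pochhammer c k.+1 = pochhammer c k * (c + k%:R).
Proof. exact: big_ord_recr. Qed.

Lemma pochhammer1 (K : numFieldType) k : pochhammer 1 k = k`!%:R :> K.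
Proof.
elim: k => [|k IHk]; first by rewrite /pochhammer big_ord0.
by rewrite pochhammerS IHk factS natrM mulrC -natr1 addrC.
Qed.

(** For [c = -1/(m+1)] this is [(c)_k (c+k) = c (c+1)_k], multiplied by [m+1]. With [n = m+1] it
    trades the parameter [-1/n] for the fraction [(n-1)/n] that the numerator list omits. *)
Lemma pochhammer_opp_inv (K : numFieldType) (m k : nat) :
  pochhammer (- (1 / m.+1%:R)) k * ((m.+1 * k)%:R - 1) =
  - pochhammer (m%:R / m.+1%:R) k :> K.
Proof.
elim: k => [|k IHk]; first by rewrite /pochhammer !big_ord0 muln0 sub0r mul1r.
rewrite !pochhammerS -[RHS]mulNr -IHk !natrM -!natr1.
have : m%:R + 1 != 0 :> K by rewrite natr1 pnatr_eq0.
by move=> ?; field.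
Qed.

Lemma prod_fractionsS {K : numFieldType} (m d : nat) (F : K -> K) :
  \prod_(c <- fractions K m.+1 d) F c =
  (\prod_(c <- fractions K m d) F c) * F (m.+1%:R / d%:R).
Proof.
have -> : fractions K m.+1 d = rcons (fractions K m d) (m.+1%:R / d%:R).
  by rewrite /fractions -map_rcons -cats1 -[m.+1]addn1 iotaD /= addnC.
by rewrite big_rcons mulrC.
Qed.

(** Gauss's multiplication formula: the parameters are [j/d] for [1 <= j <= d = m+1], the last being
    1. Raising [k] by one multiplies by the [d] factors [(dk+j)/d]. *)
Lemma prod_pochhammer_fractions (K : numFieldType) (m k : nat) :
  (\prod_(c <- fractions K m m.+1) pochhammer c k) * pochhammer 1 k =
  (m.+1 * k)`!%:R / m.+1%:R ^+ (m.+1 * k).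
Proof.
have m0 : m.+1%:R != 0 :> K by rewrite pnatr_eq0.
elim: k => [|k IHk].
  rewrite muln0 expr0 divr1 pochhammer1 mulr1 big1 // => c _.
  by rewrite /pochhammer big_ord0.
under eq_bigr => c _ do rewrite pochhammerS.
rewrite big_split /= pochhammerS mulrACA {}IHk mulnS addnC fact_addE natrM.
have -> : \prod_(c <- fractions K m m.+1) (c + k%:R) * (1 + k%:R) =
    \prod_(i < m.+1) (m.+1 * k + i.+1)%:R / m.+1%:R ^+ m.+1.
  have -> : m.+1%:R ^+ m.+1 = \prod_(i < m.+1) m.+1%:R :> K.
    by rewrite prodr_const card_ord.
  have := prod_fractionsS m m.+1 (fun c : K => c + k%:R).
  rewrite divff // => <-; rewrite -prodf_div.
  rewrite big_map -[iota _ _]/(index_iota 1 m.+2) big_add1 big_mkord.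
  by apply: eq_bigr => i _; rewrite natrD natrM; field.
rewrite natr_prod exprD; field.
by rewrite !expf_neq0.
Qed.

(** The multiplication formula is applied with [d = n] above and [d = n-1] below. Below, the
    parameter 1 is the series' own [pochhammer 1 k]; above, [(n-1)/n] comes from
    [pochhammer_opp_inv] and the missing 1 costs a division by [k!]. The powers of [n] and [n-1]
    cancel against the argument. *)
Lemma hypergeom_termE (K : numFieldType) (n k : nat) (w : K) : (2 <= n)%N ->
  hypergeom_term (- (1 / n%:R) :: fractions K (n - 2) n)
    (fractions K (n - 2) (n - 1))
    (- ((n%:R ^+ n / (n - 1)%:R ^+ (n - 1)) * w)) k =
  hcoef K n k * (- w) ^+ k.
Proof.
case: n => [|[|m]] // n2; rewrite subn1 subn2 /=.
rewrite /hypergeom_term big_cons.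
have h1 : (m.+2 * k)%:R - 1 != 0 :> K by rewrite natrM subr_eq0 natr_mul_neq1.
have m1 : m.+1%:R != 0 :> K by rewrite pnatr_eq0.
have m2 : m.+2%:R != 0 :> K by rewrite pnatr_eq0.
have := prod_pochhammer_fractions K m.+1 k; rewrite prod_fractionsS.
have := pochhammer_opp_inv K m.+1 k.
rewrite prod_pochhammer_fractions pochhammer1 /hcoef.
have := @bin_fact (m.+2 * k) k; rewrite mulSn leq_addr addKn => /(_ isT).
move=> /(congr1 (fun x => x%:R : K)).
rewrite -mulSn.
have f1 : k`!%:R != 0 :> K by rewrite pnatr_eq0 -lt0n fact_gt0.
have f2 : (m.+1 * k)`!%:R != 0 :> K by rewrite pnatr_eq0 -lt0n fact_gt0.
move: f1 f2; move: (k`!) ((m.+1 * k)`!)%N ((m.+2 * k)`!)%N => f g h f1 f2.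
rewrite !natrM => <-; rewrite -natrM.
move: (pochhammer _ _) (pochhammer _ _) => p q pq.
move: (\prod_(_ <- _) _) => A Aq.
have -> : (- (m.+2%:R ^+ m.+2 / m.+1%:R ^+ m.+1 * w)) ^+ k =
    m.+2%:R ^+ (m.+2 * k) / m.+1%:R ^+ (m.+1 * k) * (- w) ^+ k.
  by rewrite -mulrN exprMn expr_div_n -!exprM.
have qE : q = - p / ((m.+2 * k)%:R - 1) by rewrite -pq mulfK.
move: Aq (expf_neq0 (m.+2 * k) m2) (expf_neq0 (m.+1 * k) m1).
move: (_ ^+ (m.+2 * k)) (_ ^+ (m.+1 * k)) ('C(_, _)%:R : K) => x y C Aq x0 y0.
have -> : C = A * p * x / g%:R.
  apply: (mulIf f1).
  have -> : A * p * x / g%:R * f%:R = A * p * f%:R * x / g%:R by ring.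
  by rewrite Aq; field; rewrite f2 x0.
rewrite qE; move: h1; move: (_ - 1) => t t0.
by field; rewrite f2 y0 t0.
Qed.

(** * Convergence near 0 *)

Lemma horner_error_poly (K : numFieldType) (n L : nat) (s : K) : (2 <= n)%N ->
    1 - s != 0 ->
  (error_poly K n L).[s] = (1 - s) ^+ (n * L).+1 *
   (\sum_(k < L) hcoef K n k * (- (s / (1 - s) ^+ n)) ^+ k -
    ((n - 1)%:R + s) / ((n - 1)%:R * (1 - s))).
Proof.
move=> n2 s1.
have n10 : (n - 1)%:R != 0 :> K by rewrite pnatr_eq0 subn_eq0 -ltnNge.
rewrite /error_poly hornerD hornerN !hornerM horner_sum horner_exp.
rewrite !(hornerD, hornerN, hornerZ, hornerX, hornerC) mulrBr exprS.
congr (_ - _); last first.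
  (* Gives [1 - s + n s/(n-1) = ((n-1)+s)/(n-1)]. *)
  have -> : n%:R = (n - 1)%:R + 1 :> K by rewrite natr1 subn1 prednK // ltnW.
  by field; rewrite n10 s1.
rewrite -mulrA; congr (_ * _); rewrite big_distrr /=; apply: eq_bigr => k _.
rewrite hornerZ hornerM !horner_exp !(hornerD, hornerN, hornerX, hornerC).
have -> : (n * L = n * k + n * (L - k))%N by rewrite -mulnDr subnKC // ltnW.
rewrite exprD -mulNr exprMn exprVn -exprM.
field; exact: expf_neq0.
Qed.

(** On this disc [2^(n+1) |s| <= 2^-(n+1)], and since [|1-s| >= 1/2], dividing by [(1-s)^(nL+1)]
    costs at most [2^(nL+1)]; together [4 2^(nL+1) 2^(-(n+1)L) = 8 2^-L]. *)
Lemma norm_hypergeom_series_sub_le (K : numFieldType) (n L : nat) (s : K) :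
    (2 <= n)%N -> `|s| <= 2 ^- (2 * n + 2) ->
  `|hypergeom_series (- (1 / n%:R) :: fractions K (n - 2) n)
      (fractions K (n - 2) (n - 1))
      (- ((n%:R ^+ n / (n - 1)%:R ^+ (n - 1)) * (s / (1 - s) ^+ n))) L -
    ((n - 1)%:R + s) / ((n - 1)%:R * (1 - s))| <= 8 * 2 ^- L.
Proof.
move=> n2 sle.
have sle2 : `|s| <= 2^-1.
  apply: le_trans sle _; rewrite -[X in _ <= X^-1]expr1 lef_pV2 ?posrE ?exprn_gt0 //.
  by rewrite ler_eXn2l ?ltr1n // addn2.
have s1 : 2^-1 <= `|1 - s|.
  apply: le_trans (lerB_dist _ _); rewrite normr1 lerBrDr.
  by apply: le_trans (lerD (lexx _) sle2) _; rewrite -div1r -splitr.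
have s10 : 1 - s != 0 by rewrite -normr_gt0 (lt_le_trans _ s1) // invr_gt0.
have sle1 : `|s| <= 1 by apply: le_trans sle2 _; rewrite invf_le1 // ler1n.
have -> : forall a b z, hypergeom_series a b z L =
    \sum_(k < L) hypergeom_term a b z k :> K.
  by move=> a b z; rewrite /hypergeom_series seriesEord.
under eq_bigr => k _ do rewrite hypergeom_termE //.
have := norm_error_poly_le L n2 sle1.
rewrite horner_error_poly // normrM normrX.
set F := (_ + s) / _; set S := \sum_(k < L) _ => err_le.
have c0 : 0 < 2^-1 ^+ (n * L).+1 :> K by rewrite exprn_gt0 // invr_gt0.
rewrite -(ler_pM2l c0).
apply: le_trans (_ : `|1 - s| ^+ (n * L).+1 * `|S - F| <= _).
  by rewrite ler_wpM2r // lerXn2r // nnegrE invr_ge0.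
apply: le_trans err_le _.
have -> : 2^-1 ^+ (n * L).+1 * (8 * 2 ^- L) =
    4 * (2 ^+ n.+1 * 2 ^- (2 * n + 2)) ^+ L :> K.
  have -> : 2 ^+ n.+1 * 2 ^- (2 * n + 2) = 2 ^- n.+1 :> K.
    have -> : (2 * n + 2 = n.+1 + n.+1)%N by lia.
    by rewrite exprD invfM mulrA divff ?mul1r // expf_neq0.
  rewrite !exprVn -exprM mulSn exprD [_ ^+ (n * L).+1]exprS.
  have : 2 ^+ (n * L) != 0 :> K by rewrite expf_neq0.
  have : 2 ^+ L != 0 :> K by rewrite expf_neq0.
  by move: (2 ^+ L) (2 ^+ (n * L)) => x y x0 y0; field; rewrite x0 y0.
rewrite ler_wpM2l // lerXn2r ?nnegrE ?mulr_ge0 ?invr_ge0 ?exprn_ge0 //.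
by rewrite ler_wpM2l ?exprn_ge0.
Qed.

(** A positive element of [R[i]] is real, so the archimedean property of [R] applies to its real
    part. *)
Lemma exp2N_lt_complex (R : realType) (e : Cplx R) : 0 < e ->
  exists N, forall L, (N <= L)%N -> 2 ^- L < e.
Proof.
move=> e0; have eE : e = (complex.Re e)%:C%C.
  by rewrite -(gtr0_norm e0) normc_def.
have r0 : 0 < complex.Re e by move: e0; rewrite eE -[0]/(0%:C%C) ltcR.
exists (Num.bound (complex.Re e)^-1) => L NL; rewrite eE.
have -> : 2 ^- L = (2 ^- L)%:C%C :> Cplx R.
  by rewrite fmorphV rmorphXn /= rmorph_nat.
by rewrite ltcR realalg.RealAlg.upper_nthrootVP.
Qed.

Theorem theorem8p9 (R : realType) (n : nat) (hn : (2 <= n)%N) :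
  \forall s \near (0 : Cplx R),
    let a : seq (Cplx R) := - (1 / n%:R) :: fractions (Cplx R) (n - 2) n in
    let b : seq (Cplx R) := fractions (Cplx R) (n - 2) (n - 1) in
    let z : Cplx R :=
      - ((n%:R ^+ n / (n - 1)%:R ^+ (n - 1)) * (s / (1 - s) ^+ n)) in
    cvgn (hypergeom_series a b z) /\
    hypergeom a b z = ((n - 1)%:R + s) / ((n - 1)%:R * (1 - s)).
Proof.
near=> s.
have sle : `|s| <= 2 ^- (2 * n + 2).
  near: s; apply: (@cvgr0_norm_le _ _ _ (nbhs (0 : Cplx R)) _ id) => //.
set a := _ :: _; set b := fractions _ _ (n - 1); set z := - (_ / _ * _).
have cvg : hypergeom_series a b z @ \oo -->
    ((n - 1)%:R + s) / ((n - 1)%:R * (1 - s)).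
  apply/cvgrPdistC_le => e e0.
  have [N NP] : exists N, forall L, (N <= L)%N -> 2 ^- L < e / 8.
    by apply: exp2N_lt_complex; rewrite divr_gt0.
  exists N => // L /= NL.
  apply: le_trans (norm_hypergeom_series_sub_le L hn sle) _.
  by rewrite mulrC -ler_pdivlMr // ltW // NP.
split; first by apply/cvg_ex; eexists; exact: cvg.
exact: cvg_lim cvg.
Unshelve. all: by end_near.
Qed.
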